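(* For every $n\ge 1$, the SOO game on a $1\times n$ grid is a draw.
   Context: SOO game: on a $1\times n$ grid, initially empty, two players alternately write either an S or an O in an empty cell. The first player whose move produces three consecutive cells which, read from left to right, spell SOO wins (no matter who wrote the individual letters). If all cells are filled without producing SOO, the play ends in a draw. Both players are assumed to play optimally: ''the game is a draw'' means that each player has a strategy guaranteeing that they do not lose. *)

(* Defs.v *)
From HB Require Import structures.
From mathcomp Require Import all_boot.
Set Implicit Arguments.
Unset Strict Implicit.
Unset Printing Implicit Defensive.

Inductive letter := LetterS | LetterO.

Definition letter_is_S (l : letter) : bool :=
  if l is LetterS then true else false.
Definition letter_of_bool (b : bool) : letter :=
  if b then LetterS else LetterO.
Lemma letter_is_SK : cancel letter_is_S letter_of_bool.
Proof. by case. Qed.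
HB.instance Definition _ := Finite.copy letter (can_type letter_is_SK).

Inductive player := First | Second.

Definition opponent (p : player) : player :=
  if p is First then Second else First.

Definition board (n : nat) := {ffun 'I_n -> option letter}.

Definition empty_board (n : nat) : board n := [ffun=> None].

Definition move (n : nat) := ('I_n * letter)%type.

Definition write (n : nat) (b : board n) (m : move n) : board n :=
  [ffun i => if i == m.1 then Some m.2 else b i].

(* Histories list the moves in chronological order. *)
Definition history (n : nat) := seq (move n).

Definition board_after (n : nat) (h : history n) : board n :=
  foldl (@write n) (empty_board n) h.

Definition to_move (n : nat) (h : history n) : player :=
  if odd (size h) then Second else First.

Definition has_SOO (n : nat) (b : board n) : bool :=
  [exists i : 'I_n, exists j : 'I_n, exists k : 'I_n,
    [&& j == i.+1 :> nat, k == j.+1 :> nat,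
        b i == Some LetterS, b j == Some LetterO & b k == Some LetterO]].

(* The first conjunct says that the play stops as soon as SOO appears. *)
Definition legal_move (n : nat) (h : history n) (m : move n) : bool :=
  ~~ has_SOO (board_after h) && (board_after h m.1 == None).

Inductive play (n : nat) : history n -> Prop :=
| play_nil : play [::]
| play_rcons (h : history n) (m : move n) :
    play h -> legal_move h m -> play (rcons h m).

(* Since no move is legal once SOO has appeared, in a play containing SOO it
   was produced by the last move, which was made by the player who is not to
   move. *)
Definition wins (n : nat) (p : player) (h : history n) : Prop :=
  has_SOO (board_after h) /\ to_move h = opponent p.

Definition strategy (n : nat) := history n -> move n.

Definition legal_strategy (n : nat) (p : player) (s : strategy n) : Prop :=
  forall h : history n, play h -> to_move h = p ->
    (exists m : move n, legal_move h m) -> legal_move h (s h).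

(* The plays, finished or not, in which [p] follows [s] and the opponent moves
   arbitrarily. *)
Inductive play_with (n : nat) (p : player) (s : strategy n) :
    history n -> Prop :=
| play_with_nil : play_with p s [::]
| play_with_rcons (h : history n) (m : move n) :
    play_with p s h -> legal_move h m -> (to_move h = p -> m = s h) ->
    play_with p s (rcons h m).

Definition nonlosing_strategy (n : nat) (p : player) (s : strategy n) : Prop :=
  legal_strategy p s /\
  forall h : history n, play_with p s h -> ~ wins (opponent p) h.

Definition SOO_game_is_draw (n : nat) : Prop :=
  forall p : player, exists s : strategy n, nonlosing_strategy p s.

(* Main.v *)
Require Import Defs.
From mathcomp Require Import all_boot.

(** Call a board quiet if no single letter written in an empty cell completes
    SOO.  A player who hands over a quiet board cannot lose on the next move, so
    a player does not lose if all boards handed over are quiet or already won.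
    This can always be arranged: if the opponent leaves a board that is not
    quiet, complete SOO and win; otherwise write an S in the rightmost empty
    cell.  The latter move keeps the board quiet (quiet_write_rightmost): an S
    can only be the first letter of SOO, and all cells to the right of the new S
    are already filled, so a later single move that completes SOO cannot use the
    new S and would have completed SOO before it was written.  The argument is
    symmetric in the players and does not depend on n. *)

Section SOO.
Context {n : nat}.
Implicit Types (b : board n) (h : history n) (m : move n) (p : player).

Lemma has_SOOP b :
  reflect (exists i j k : 'I_n,
             [/\ j = i.+1 :> nat, k = j.+1 :> nat, b i = Some LetterS,
                 b j = Some LetterO & b k = Some LetterO])
          (has_SOO b).
Proof.
apply: (iffP idP) => [|[i [j [k [ij jk bi bj bk]]]]].
  case/existsP => i /existsP[j /existsP[k]].
  by case/and5P => /eqP ij /eqP jk /eqP bi /eqP bj /eqP bk; exists i, j, k.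
by apply/existsP; exists i; apply/existsP; exists j; apply/existsP; exists k;
  apply/and5P; split; apply/eqP.
Qed.

Definition completes_SOO b m : bool := (b m.1 == None) && has_SOO (write b m).

Definition quiet b : Prop := forall m, ~~ completes_SOO b m.

Definition rightmost_empty b (i : 'I_n) : bool :=
  (b i == None) && [forall j : 'I_n, (b j == None) ==> (j <= i)].

Lemma exists_rightmost_empty b (i0 : 'I_n) :
  b i0 == None -> exists i, rightmost_empty b i.
Proof.
move=> bi0; case: (@arg_maxnP _ i0 (fun i => b i == None) val bi0) => i bi imax.
exists i; rewrite /rightmost_empty bi.
by apply/forallP => j; apply/implyP => /imax.
Qed.

Lemma empty_board_no_SOO : ~~ has_SOO (empty_board n).
Proof. by apply/has_SOOP => -[i [j [k [_ _]]]]; rewrite ffunE. Qed.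

Lemma quiet_empty_board : quiet (empty_board n).
Proof.
move=> [c l]; apply/negP => /andP[_ /has_SOOP[i [j [k [_ jk]]]]].
(* The two O's would both have to be in the only written cell. *)
rewrite !ffunE /= => _; case: eqP => // jc _; case: eqP => // kc.
by move: jk; rewrite jc kc => /n_Sn.
Qed.

Lemma quiet_write_rightmost b (r : 'I_n) :
  quiet b -> rightmost_empty b r -> quiet (write b (r, LetterS)).
Proof.
move=> qb /andP[br /forallP rmax] [c l]; apply/negP => /andP[/= wc].
have cr : c != r by apply: contraTneq wc => ->; rewrite ffunE eqxx.
have bc : b c == None by move: wc; rewrite ffunE (negbTE cr).
have ltcr : c < r by rewrite ltn_neqAle (implyP (rmax c) bc) andbT.
case/has_SOOP => i [j [k [ij jk]]]; rewrite !ffunE /= => wi wj wk.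
have [ir|nir] := eqVneq i r.
  (* The letter at c is to the left of this SOO, so writing the S had already
     completed it. *)
  have gtc (x : 'I_n) : r <= x -> (x == c) = false.
    by move=> rx; apply/eqP => xc; move: ltcr; rewrite -xc ltnNge rx.
  have rj : r <= j by rewrite ij ir.
  have rk : r <= k by rewrite jk leqW.
  apply: (negP (qb (r, LetterS))); rewrite /completes_SOO br /=.
  apply/has_SOOP; exists i, j, k; split=> //.
  - by rewrite ffunE /= ir eqxx.
  - by move: wj; rewrite gtc // ffunE.
  - by move: wk; rewrite gtc // ffunE.
(* The new S is not part of this SOO, so it could be completed without it. *)
apply: (negP (qb (c, l))); rewrite /completes_SOO bc /=.
apply/has_SOOP; exists i, j, k; split=> //; rewrite ffunE /=.
- by move: wi; rewrite (negbTE nir).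
- by move: wj; case: (j == c) => //; case: (j == r).
- by move: wk; case: (k == c) => //; case: (k == r).
Qed.

(** The default move [d] is only returned on a full board. *)
Definition win_or_rightmost_S (d : move n) b : move n :=
  if [pick m | completes_SOO b m] is Some m then m
  else if [pick i | rightmost_empty b i] is Some i then (i, LetterS) else d.

Lemma win_or_rightmost_S_spec d b (i0 : 'I_n) (m := win_or_rightmost_S d b) :
  b i0 == None ->
  b m.1 == None /\ (has_SOO (write b m) \/ quiet (write b m)).
Proof.
move=> bi0; rewrite {}/m /win_or_rightmost_S.
case: pickP => [m /andP[bm wm]|noSOO]; first by split=> //; left.
case: pickP => [i ri|none]; last first.
  by have [i] := exists_rightmost_empty _ _ bi0; rewrite none.
split; first by case/andP: ri.
by right; apply: quiet_write_rightmost => // m; rewrite noSOO.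
Qed.

Lemma board_after_rcons h m :
  board_after (rcons h m) = write (board_after h) m.
Proof. exact: foldl_rcons. Qed.

Lemma to_move_rcons h m : to_move (rcons h m) = opponent (to_move h).
Proof. by rewrite /to_move size_rcons /=; case: odd. Qed.

Lemma to_moveP p h : to_move h = p \/ to_move h = opponent p.
Proof. by case: to_move p => -[]; [left|right|right|left]. Qed.

Lemma opponentK : involutive opponent.
Proof. by case. Qed.

Lemma opponent_neq p : opponent p <> p.
Proof. by case: p. Qed.

(** The invariant that makes the strategy non-losing: at [p]'s turn SOO has not
    appeared, and at the opponent's turn [p] has just won or left a quiet
    board. *)
Lemma win_or_rightmost_S_invariant d p h :
  play_with p (fun h => win_or_rightmost_S d (board_after h)) h ->
  (to_move h = p -> ~~ has_SOO (board_after h)) /\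
  (to_move h = opponent p ->
     has_SOO (board_after h) \/ quiet (board_after h)).
Proof.
elim=> [|{}h m _ [_ IHopp] /andP[noSOO empty_m] follows].
  by split=> _; [exact: empty_board_no_SOO | right; exact: quiet_empty_board].
rewrite to_move_rcons board_after_rcons.
have [hp|hp] := to_moveP p h; rewrite hp.
  split=> [/opponent_neq //|_]; rewrite (follows hp).
  by have [] := win_or_rightmost_S_spec d _ _ empty_m.
rewrite opponentK; split=> [_|/esym /opponent_neq //].
have [yesSOO|qh] := IHopp hp; first by rewrite yesSOO in noSOO.
by have := qh m; rewrite /completes_SOO empty_m.
Qed.

End SOO.

Theorem theorem4 (n : nat) (hn : 1 <= n) : SOO_game_is_draw n.
Proof.
move=> p; pose d : move n := (Ordinal hn, LetterS).
exists (fun h => win_or_rightmost_S d (board_after h)); split.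
  move=> h _ _ [m /andP[noSOO empty_m]]; rewrite /legal_move noSOO.
  by have [] := win_or_rightmost_S_spec d _ _ empty_m.
move=> h /win_or_rightmost_S_invariant[noSOO _] [yesSOO].
by rewrite opponentK => /noSOO; rewrite yesSOO.
Qed.
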